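(* Let $\{s_k\}_{k=0}^\infty$ be a sequence of positive real numbers satisfying $$s_{n-1}s_{n+1}\ge 4 s_n^2\qquad\text{for all } n=1,2,3,\ldots.$$ Then $\{s_k\}_{k=0}^\infty$ is a Hamburger moment sequence.
   Context: A sequence of positive numbers $\{s_k\}_{k=0}^\infty$ is the moment sequence of a nondecreasing function $F:\mathbf{R}\to\mathbf{R}$ if $s_k=\int_{-\infty}^\infty t^k\,dF(t)$ for all $k\ge 0$ (Stieltjes integral). A sequence of positive numbers is called a Hamburger moment sequence if it is the moment sequence of such a nondecreasing function $F$ having infinitely many points of growth (equivalently, the corresponding measure $dF$ has infinite support). *)

(* Defs.v *)
From HB Require Import structures.
From mathcomp Require Import all_boot all_order all_algebra.
From mathcomp Require Import all_classical all_reals all_analysis.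

Set Implicit Arguments.
Unset Strict Implicit.
Unset Printing Implicit Defensive.

Import Order.TTheory GRing.Theory Num.Theory.
Import numFieldNormedType.Exports.

Local Open Scope classical_set_scope.
Local Open Scope ring_scope.

Section right_limit.
Context {R : realType} (F : R -> R) (ndF : nondecreasing F).

(* The integral with respect to [dF] of a continuous function does not depend
   on the values of [F] at its jumps, so an arbitrary nondecreasing [F] is
   integrated against through its right-continuous version [x |-> F (x+)],
   as the library's Lebesgue-Stieltjes measures require. The proof [ndF] is
   recorded so that the result is canonically a [cumulative]. *)
Definition right_limit of nondecreasing F : R -> R := fun x => lim (F @ x^'+).

Lemma right_limit_cvg x : F @ x^'+ --> right_limit ndF x.
Proof.
apply: nondecreasing_at_right_is_cvgr.
  by apply: nearW => y z t _ _; exact: ndF.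
near=> y; exists (F x) => _ /= [t /itvP tx <-].
by apply: ndF; rewrite tx.
Unshelve. all: by end_near. Qed.

Lemma right_limit_ge x : F x <= right_limit ndF x.
Proof.
apply: (cvgr_to_ge (@right_limit_cvg x)).
by near=> y; apply: ndF.
Unshelve. all: by end_near. Qed.

Lemma right_limit_le x y : x < y -> right_limit ndF x <= F y.
Proof.
move=> xy; apply: (cvgr_to_le (@right_limit_cvg x)).
by near=> z; apply: ndF; near: z; exact: nbhs_right_le.
Unshelve. all: by end_near. Qed.

Lemma right_limit_nd : nondecreasing (right_limit ndF).
Proof.
move=> x y; rewrite le_eqVlt => /predU1P[->//|xy].
exact: le_trans (right_limit_le xy) (right_limit_ge y).
Qed.

Lemma right_limit_rc : right_continuous (right_limit ndF).
Proof.
move=> x; apply/cvgrPdist_le => e e0.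
have /cvgrPdist_le/(_ e e0) [d /= d0 Fd] := @right_limit_cvg x.
near=> y.
have xy : x < y by [].
pose z := y + (x + d - y) / 2.
have yxd : y < x + d by near: y; apply: nbhs_right_lt; rewrite ltrDl.
have yz : y < z by rewrite ltrDl divr_gt0// subr_gt0.
have zxd : z < x + d.
  by rewrite -ltrBrDl ltr_pdivrMr// ltr_pMr ?subr_gt0// ltr1n.
have /Fd : ball x d z.
  rewrite /ball /= distrC gtr0_norm ?subr_gt0 ?(lt_trans xy)//.
  by rewrite ltrBlDl.
move=> /(_ (lt_trans xy yz)).
rewrite !(distrC (right_limit ndF x)) !ger0_norm ?subr_ge0 //.
- by apply: le_trans; rewrite lerB// right_limit_le.
- exact/right_limit_nd/ltW.
- exact/right_limit_le/(lt_trans xy).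
Unshelve. all: by end_near. Qed.

HB.instance Definition _ :=
  isCumulative.Build R _ R (right_limit ndF) right_limit_nd right_limit_rc.

End right_limit.

Definition stieltjes_measure {R : realType} (F : R -> R)
    (ndF : nondecreasing F) : {measure set (measurableTypeR R) -> \bar R} :=
  lebesgue_stieltjes_measure (right_limit ndF).

Definition moment_sequence {R : realType} (F : R -> R) (ndF : nondecreasing F)
    (s : nat -> R) : Prop :=
  forall k,
    (stieltjes_measure ndF).-integrable setT (fun t : R => (t ^+ k)%:E) /\
    (s k)%:E = (\int[stieltjes_measure ndF]_t (t ^+ k)%:E)%E.

Definition growth_point {R : realType} (F : R -> R) (x : R) : Prop :=
  forall e, 0 < e -> F (x - e) < F (x + e).

Definition hamburger_moment_sequence {R : realType} (s : nat -> R) : Prop :=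
  (forall k, 0 < s k) /\
  exists (F : R -> R) (ndF : nondecreasing F),
    moment_sequence ndF s /\ infinite_set [set x | growth_point F x].

(* Main.v *)
From HB Require Import structures.
Require Import Defs.
From mathcomp Require Import all_boot all_order all_algebra.
From mathcomp Require Import all_classical all_reals all_analysis.
From mathcomp Require Import measurable_realfun.
From mathcomp Require Import ring lra zify.

Set Implicit Arguments.
Unset Strict Implicit.
Unset Printing Implicit Defensive.

Import Order.TTheory GRing.Theory Num.Theory.
Import numFieldNormedType.Exports.

Local Open Scope classical_set_scope.
Local Open Scope ring_scope.

(** Write L for the linear functional on polynomials with L('X^k) = s k. The
proof has two halves.

Algebra: L(p^2) > 0 for every p != 0. Orthogonal polynomials for all the shifted
functionals p |-> L('X^n p) are built together, by Rutishauser's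
quotient-difference recurrences, whose entries q and e start from
q = s n.+1 / s n. Their squared norms are products of entries e and of some
s n, so everything reduces to e > 0. The hypothesis says that the
first row satisfies q^(n+1) >= 4 q^(n), and the bounds
  q_k^(n+1) >= ((k+1)/k)^2 q_k^(n),
  (1 - 1/(k+1)^2) q_k^(n+1) <= e_k^(n) <= q_k^(n+1)
reproduce themselves from one row to the next (qd_bounds). This is where the
constant 4 comes from: it is ((k+1)/k)^2 at k = 1. A polynomial that is
nonnegative on the line is a sum of squares (poly_ge0_sum_sqr), so L is
nonnegative on such polynomials.

Analysis: f |-> inf {L p | p >= f} is a sublinear functional on the bounded
functions; by Hahn-Banach it dominates a linear functional, whose values on the
indicators of the half-lines define F. Lower step functions and
Fatou's lemma give that the integral of p against dF is at most L p for every
p >= 0 (integral_le_L), and a Chebyshev estimate gives that dF has mass exactly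
s 0. Thus E(p) = L p - (integral of p dF) is a positive functional with
E(1) = 0, and the Cauchy-Schwarz inequality E(p)^2 <= E(1) E(p^2) forces E = 0
(integral_horner): F has the prescribed moments. Finally, if the points of growth
were the roots of a polynomial p, then dF would be supported there and
L(p^2) = 0, which strict positivity excludes (infinite_growth). *)

(** * The quotient-difference scheme *)

Section QuotientDifference.
Context {R : realType} (s : nat -> R).

(** Row [k] of the table, at superscript [n], holds the pair usually written
q_(k+1)^(n), e_(k+1)^(n); the boundary row e_0 = 0 is built into the first
case. *)
Fixpoint qd k n : R * R :=
  if k is k'.+1 then
    let q m := (qd k' m.+1).1 * (qd k' m.+1).2 / (qd k' m).2 in
    (q n, q n.+1 - q n + (qd k' n.+1).2)
  else let q m := s m.+1 / s m in (q n, q n.+1 - q n).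

Definition qd_q k n := (qd k n).1.
Definition qd_e k n := (qd k n).2.

Lemma qd_qS k n : qd_q k.+1 n = qd_q k n.+1 * qd_e k n.+1 / qd_e k n.
Proof. by []. Qed.

Lemma qd_e0 n : qd_e 0 n = qd_q 0 n.+1 - qd_q 0 n.
Proof. by []. Qed.

Lemma qd_eS k n :
  qd_e k.+1 n = qd_q k.+1 n.+1 - qd_q k.+1 n + qd_e k n.+1.
Proof. by []. Qed.

Hypothesis s_gt0 : forall k, 0 < s k.
Hypothesis s_ineq : forall n, 4 * s n.+1 ^+ 2 <= s n * s n.+2.

(** All four bounds are needed together. For the ratio of consecutive q's
in the new row, e <= q removes two factors e^(n+1) from a denominator, and what
remains is bounded below by the two previous lower bounds. For e in the new row,
the rhombus rule writes q - e of the old shift as q (1 - e / q), which is small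
because e is close to q in the old row. *)
Lemma qd_bounds k n :
  [/\ 0 < qd_q k n,
      (k.+2%:R ^+ 2) * qd_q k n <= (k.+1%:R ^+ 2) * qd_q k n.+1,
      (k.+2%:R ^+ 2 - 1) * qd_q k n.+1 <= k.+2%:R ^+ 2 * qd_e k n &
      qd_e k n <= qd_q k n.+1].
Proof.
elim: k n => [|k IHk] n.
  have q0 m : 0 < qd_q 0 m by rewrite /qd_q /= divr_gt0.
  have qq m : 4 * qd_q 0 m <= qd_q 0 m.+1.
    rewrite /qd_q /= ler_pdivlMr// mulrA mulrAC ler_pdivrMr//.
    by have := s_ineq m; lra.
  rewrite qd_e0; have := q0 n; have := qq n; have := q0 n.+1.
  by split=> //; rewrite ?expr2; lra.
pose a : R := k.+1%:R.
have a0 : 0 < a by rewrite ltr0n.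
have aS : k.+2%:R = a + 1 by rewrite /a -natr1.
have aSS : k.+3%:R = a + 2 by rewrite -natr1 aS; lra.
rewrite aS aSS in IHk *.
rewrite -/a in IHk *.
have a1 : 0 < a + 1 by lra.
have a2 : 0 < a + 2 by lra.
have q0 m : 0 < qd_q k m by have [] := IHk m.
have e0 m : 0 < qd_e k m.
  have [_ _ H _] := IHk m.
  have : 0 < ((a + 1) ^+ 2 - 1) * qd_q k m.+1.
    by apply: mulr_gt0; [nra|exact: q0].
  by move=> /lt_le_trans/(_ H); rewrite pmulr_rgt0// exprn_gt0.
have eq m : qd_e k m <= qd_q k m.+1 by have [] := IHk m.
have q'0 m : 0 < qd_q k.+1 m by rewrite qd_qS divr_gt0 ?mulr_gt0.
have q'q m : (a + 2) ^+ 2 * qd_q k.+1 m <= (a + 1) ^+ 2 * qd_q k.+1 m.+1.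
  rewrite !qd_qS mulrA [leRHS]mulrA ler_pdivrMr// [leRHS]mulrAC ler_pdivlMr//.
  (* Combines the ratio bound and the lower bound on e at superscript m + 2. *)
  have He2 : (a + 2) * qd_q k m.+2 <= a * qd_e k m.+2.
    have [_ Hq _ _] := IHk m.+2; have [_ _ He _] := IHk m.+2.
    have h : (a + 1) ^+ 2 * a * ((a + 2) * qd_q k m.+2) <=
        (a + 1) ^+ 2 * a * (a * qd_e k m.+2).
      have := ler_wpM2l (ltW (mulr_gt0 a0 a2)) Hq.
      have := ler_wpM2l (sqr_ge0 a) He.
      by lra.
    by move: h; rewrite ler_pM2l// mulr_gt0// exprn_gt0.
  have [_ _ He _] := IHk m.
  have He0 : a * (a + 2) * qd_q k m.+1 <= (a + 1) ^+ 2 * qd_e k m by lra.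
  have H1 : (a * (a + 2) * qd_q k m.+1) * ((a + 2) * qd_q k m.+2) <=
      ((a + 1) ^+ 2 * qd_e k m) * (a * qd_e k m.+2).
    by apply: ler_pM => //; rewrite !mulr_ge0// ?ltW// ltr_wpDl.
  have H2 : (a + 2) ^+ 2 * qd_q k m.+1 * qd_q k m.+2 <=
      (a + 1) ^+ 2 * qd_e k m * qd_e k m.+2.
    by rewrite -(ler_pM2l a0); lra.
  have H3 : qd_e k m.+1 * qd_e k m.+1 <= qd_q k m.+2 * qd_q k m.+2.
    by apply: ler_pM => //; exact: ltW.
  have H4 := ler_wpM2l (ltW (mulr_gt0 (exprn_gt0 2 a2) (q0 m.+1))) H3.
  have H5 := ler_wpM2r (ltW (q0 m.+2)) H2.
  by lra.
have e'E : qd_e k.+1 n = qd_q k.+1 n.+1 - qd_q k.+1 n + qd_e k n.+1 by [].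
have qE : qd_q k.+1 n * qd_e k n = qd_q k n.+1 * qd_e k n.+1.
  by rewrite qd_qS divfK// gt_eqF.
split => //.
- rewrite e'E.
  suff H : (a + 1) ^+ 2 * (qd_q k.+1 n - qd_e k n.+1) <= qd_q k.+1 n.
    rewrite -(@ler_pM2l _ ((a + 1) ^+ 2)); last by rewrite exprn_gt0.
    have := q'q n; have H2 := ler_wpM2l (sqr_ge0 (a + 2)) H.
    by lra.
  rewrite -(@ler_pM2l _ (qd_q k n.+1))//.
  have [_ _ He _] := IHk n.
  have := ler_wpM2l (ltW (q'0 n)) He.
  have : (a + 1) ^+ 2 * (qd_q k.+1 n * qd_e k n) = (a + 1) ^+ 2 * (qd_q k n.+1 * qd_e k n.+1).
    by rewrite qE.
  by lra.
- rewrite e'E.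
  suff : qd_e k n.+1 <= qd_q k.+1 n by lra.
  by rewrite qd_qS ler_pdivlMr// mulrC ler_pM2r.
Qed.

Lemma qd_q_gt0 k n : 0 < qd_q k n.
Proof. by have [] := qd_bounds k n. Qed.

Lemma qd_e_gt0 k n : 0 < qd_e k n.
Proof.
have [_ _ + _] := qd_bounds k n.
have k2 : 1 < k.+2%:R ^+ 2 :> R by rewrite exprn_egt1 // ltr1n.
move=> /(lt_le_trans (mulr_gt0 _ (qd_q_gt0 k n.+1))).
by rewrite subr_gt0 => /(_ k2); rewrite pmulr_rgt0 ?(lt_trans _ k2).
Qed.

End QuotientDifference.

(** * Orthogonal polynomials and positivity on squares *)

Section MomentFunctional.
Context {R : realType}.

Definition moment_functional (s : nat -> R) (p : {poly R}) : R :=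
  \sum_(i < size p) p`_i * s i.

Lemma moment_functionalE s n (p : {poly R}) : (size p <= n)%N ->
  moment_functional s p = \sum_(i < n) p`_i * s i.
Proof.
move=> pn; rewrite /moment_functional (big_ord_widen_cond _ xpredT (fun i => p`_i * s i) pn).
rewrite big_mkcond; apply: eq_bigr => i _ /=.
by case: ltnP => // /leq_sizeP ->//; rewrite mul0r.
Qed.

Lemma moment_functional_is_linear s : linear_for *%R (moment_functional s).
Proof.
move=> c p q; pose n := maxn (size p) (size q).
have pn : (size p <= n)%N by rewrite leq_maxl.
have qn : (size q <= n)%N by rewrite leq_maxr.
rewrite !(@moment_functionalE _ n)//; last first.
  apply: leq_trans (size_polyD _ _) _; rewrite geq_max qn andbT.
  exact: leq_trans (size_scale_leq _ _) pn.
rewrite mulr_sumr -big_split; apply: eq_bigr => i _ /=.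
by rewrite coefD coefZ mulrDl mulrA.
Qed.

HB.instance Definition _ s :=
  GRing.isLinear.Build R {poly R} R *%R (moment_functional s)
    (moment_functional_is_linear s).

Lemma moment_functionalXn s n : moment_functional s 'X^n = s n.
Proof.
rewrite (@moment_functionalE _ n.+1) ?size_polyXn// big_ord_recr /=.
rewrite coefXn eqxx mul1r big1 ?add0r// => i _.
by rewrite coefXn (ltn_eqF (ltn_ord i)) mul0r.
Qed.

Lemma moment_functional1 s : moment_functional s 1 = s 0%N.
Proof. by rewrite -(expr0 'X) moment_functionalXn. Qed.

Lemma moment_functionalMX s p :
  moment_functional s (p * 'X) = moment_functional (fun i => s i.+1) p.
Proof.
rewrite (@moment_functionalE s (size p).+1); last first.
  by rewrite (leq_trans (size_polyMleq _ _))// size_polyX addn2.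
rewrite big_ord_recl coefMX eqxx mul0r add0r.
by apply: eq_bigr => i _; rewrite coefMX.
Qed.

End MomentFunctional.

Section OrthogonalPolynomials.
Context {R : realType} (s : nat -> R).
Hypothesis s_gt0 : forall k, 0 < s k.
Hypothesis s_ineq : forall n, 4 * s n.+1 ^+ 2 <= s n * s n.+2.

Local Notation q := (qd_q s).
Local Notation e := (qd_e s).
Local Notation L n := (moment_functional (fun i => s (n + i)%N)).

(** The monic orthogonal polynomial of degree [k] for the functional
p |-> L('X^n p). *)
Fixpoint orthopoly k n : {poly R} :=
  if k is k'.+1 then orthopoly k' n.+1 * 'X - q k' n *: orthopoly k' n else 1.

(** The squared norm of [orthopoly k n]; in terms of Hankel determinants it
is the quotient of the determinants of orders [k.+1] and [k]. *)
Fixpoint orthonorm k n : R :=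
  if k is k'.+1 then e k' n * orthonorm k' n.+1 else s n.

Lemma orthopolyS k n :
  orthopoly k.+1 n = orthopoly k n.+1 * 'X - q k n *: orthopoly k n.
Proof. by []. Qed.

Lemma orthonorm_gt0 k n : 0 < orthonorm k n.
Proof.
by elim: k n => //= k IHk n; rewrite mulr_gt0// qd_e_gt0.
Qed.

Lemma orthonorm_shift k n : orthonorm k n.+1 = q k n * orthonorm k n.
Proof.
elim: k n => [|k IHk] n /=; first by rewrite /qd_q /= divfK ?gt_eqF.
rewrite IHk qd_qS !mulrA divfK ?gt_eqF ?qd_e_gt0//.
by rewrite [q k n.+1 * _]mulrC.
Qed.

Lemma orthopoly_monic k n : (orthopoly k n \is monic) /\ size (orthopoly k n) = k.+1.
Proof.
elim: k n => [|k IHk] n; first by rewrite monic1 size_poly1.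
have [m1 s1] := IHk n.+1; have [_ s0] := IHk n.
have sX : size (orthopoly k n.+1 * 'X) = k.+2 by rewrite size_mulX ?monic_neq0// s1.
have lt : (size (- (q k n *: orthopoly k n)) < size (orthopoly k n.+1 * 'X)%R)%N.
  by rewrite sX size_polyN ltnS (leq_trans (size_scale_leq _ _))// s0.
rewrite orthopolyS monicE lead_coefDl// size_polyDl// sX.
by rewrite -monicE monicMr// monicX.
Qed.

(** The second contiguous relation, companion to the defining one: both
sides are monic and orthogonal to the same powers. It is proved here from the
quotient-difference rules alone, so that no uniqueness argument is needed. *)
Lemma orthopoly_shift k n :
  orthopoly k.+1 n = orthopoly k.+1 n.+1 + e k n *: orthopoly k n.+1.
Proof.
elim: k n => [|k IHk] n.
  by rewrite /= qd_e0 scalerBl; ring.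
have IH0 := IHk n; have IH1 := IHk n.+1.
rewrite (orthopolyS k.+1 n) (orthopolyS k.+1 n.+1) qd_eS.
have qe : q k.+1 n * e k n = q k n.+1 * e k n.+1.
  by rewrite qd_qS divfK ?gt_eqF ?qd_e_gt0.
have X2 : orthopoly k n.+2 * 'X = orthopoly k.+1 n.+1 + q k n.+1 *: orthopoly k n.+1.
  by rewrite orthopolyS subrK.
rewrite -!mul_polyC in X2 IH0 IH1 *.
rewrite {1}IH1 mulrDl -mulrA X2 IH0 !(polyCD, polyCN).
move/(congr1 polyC): qe; rewrite !polyCM => qe; ring: qe.
Qed.

Lemma moment_functional_shift n p : L n (p * 'X) = L n.+1 p.
Proof.
rewrite moment_functionalMX; congr moment_functional; apply/funext => i.
by rewrite addnS addSn.
Qed.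

(** The defining recurrence passes orthogonality from degree [k] to [k.+1]:
the coefficient q is exactly the one that kills the pairing with 'X^k. The
norm then comes from the second contiguous relation. *)
Lemma orthopoly_orth k n :
  (forall j, (j < k)%N -> L n (orthopoly k n * 'X^j) = 0) /\
  L n (orthopoly k n * 'X^k) = orthonorm k n.
Proof.
elim: k n => [|k IHk] n.
  split => //; rewrite /= mul1r moment_functional1 addn0 //.
have orth_low m j : (j < k.+1)%N -> L m (orthopoly k.+1 m * 'X^j) = 0.
  move=> jk; rewrite orthopolyS mulrBl linearB /= -scalerAl linearZ /=.
  rewrite mulrAC moment_functional_shift.
  have [lo1 top1] := IHk m.+1; have [lo0 top0] := IHk m.
  move: jk; rewrite ltnS leq_eqVlt => /predU1P[->|jk].
    by rewrite top1 top0 orthonorm_shift subrr.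
  by rewrite lo1// lo0// mulr0 subrr.
split; first exact: orth_low.
rewrite exprSr mulrA moment_functional_shift orthopoly_shift mulrDl linearD /=.
by rewrite orth_low// add0r -scalerAl linearZ /=; have [_ ->] := IHk n.+1.
Qed.

Lemma orthopoly_orth_lt k n (p : {poly R}) : (size p <= k)%N -> L n (orthopoly k n * p) = 0.
Proof.
move=> pk; rewrite -[p]coefK poly_def mulr_sumr linear_sum big1// => i _.
rewrite -scalerAr linearZ /= (orthopoly_orth k n).1 ?mulr0//.
exact: leq_trans pk.
Qed.

Lemma orthopoly_norm k n : L n (orthopoly k n ^+ 2) = orthonorm k n.
Proof.
have [mon sz] := orthopoly_monic k n.
have -> : orthopoly k n ^+ 2 = orthopoly k n * 'X^k +
    orthopoly k n * (orthopoly k n - 'X^k) by rewrite expr2; ring.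
rewrite linearD /= (orthopoly_orth k n).2 orthopoly_orth_lt ?addr0//.
apply/leq_sizeP => j; rewrite leq_eqVlt coefB coefXn => /predU1P[<-|kj].
  by move: mon; rewrite monicE lead_coefE sz => /eqP ->; rewrite eqxx subrr.
by rewrite gtn_eqF// subr0 nth_default// sz.
Qed.

(** Division by the monic [orthopoly k 0] splits off the leading term, and
orthogonality removes the cross term. *)
Lemma moment_functional_sqr_gt0 p : p != 0 -> 0 < moment_functional s (p ^+ 2).
Proof.
suff H n : forall p : {poly R}, (size p <= n)%N ->
    0 <= L 0 (p ^+ 2) /\ (p != 0 -> 0 < L 0 (p ^+ 2)).
  by move=> p0; have [_ /(_ p0)] := H _ p (leqnn _).
elim: n => [|k IHk] {}p.
  by rewrite leqn0 size_poly_eq0 => /eqP ->; rewrite eqxx expr0n /= linear0.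
move=> pk; have [mon sz] := orthopoly_monic k 0.
pose c := p`_k; pose r := p - c *: orthopoly k 0.
have rk : (size r <= k)%N.
  apply/leq_sizeP => j; rewrite leq_eqVlt coefB coefZ => /predU1P[<-|kj].
    by move: mon; rewrite monicE lead_coefE sz => /eqP ->; rewrite mulr1 subrr.
  rewrite [X in _ * X]nth_default ?sz// mulr0 subr0 nth_default//.
  exact: leq_trans pk _.
have E : L 0 (p ^+ 2) = c ^+ 2 * orthonorm k 0 + L 0 (r ^+ 2).
  have -> : p ^+ 2 = c ^+ 2 *: orthopoly k 0 ^+ 2
      + (2 * c) *: (orthopoly k 0 * r) + r ^+ 2.
    have -> : p = c *: orthopoly k 0 + r by rewrite /r addrC subrK.
    by rewrite -!mul_polyC !polyCM; ring.
  rewrite !linearD !linearZ /= orthopoly_norm orthopoly_orth_lt//.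
  by rewrite mulr0 addr0.
have [r0 rp] := IHk _ rk.
have h0 := orthonorm_gt0 k 0.
rewrite E; split => [|p0]; first by rewrite addr_ge0// mulr_ge0 ?sqr_ge0// ltW.
have [c0|c0] := eqVneq c 0; last first.
  by rewrite ltr_pwDl// mulr_gt0// exprn_even_gt0.
rewrite c0 expr0n /= mul0r add0r; apply: rp.
by rewrite /r c0 scale0r subr0.
Qed.

End OrthogonalPolynomials.

(** * Nonnegative polynomials are sums of squares *)

Section NonnegativePolynomials.
Context {R : realType}.

Lemma poly_coercive (p : {poly R}) (M : R) : (1 < size p)%N ->
  exists2 A : R, 0 <= A & forall x : R, A <= `|x| -> M <= `|p.[x]|.
Proof.
elim/poly_ind: p M => [|p c IHp] M; first by rewrite size_poly0.
rewrite size_MXaddC; case: ifP => // _; rewrite ltnS => p0.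
have bnd (x : R) : `|p.[x]| * `|x| - `|c| <= `|(p * 'X + c%:P).[x]|.
  rewrite hornerMXaddC -normrM lerBlDr.
  by rewrite -[X in `|X| <= _](addrK c) (le_trans (ler_normB _ _)).
have [p1|p1] := leqP (size p) 1.
  have [a aE] : exists a, p = a%:P by exists p`_0; exact: size1_polyC.
  have a0 : 0 < `|a|.
    by rewrite normr_gt0; move: p0; rewrite aE size_polyC; case: eqP.
  exists (Num.max 0 ((M + `|c|) / `|a|)); first by rewrite le_max lexx.
  move=> x; rewrite ge_max ler_pdivrMr// => /andP[_ xM].
  by apply: le_trans (bnd x); rewrite aE hornerC mulrC lerBrDr.
have [A A0 HA] := IHp (Num.max 0 (M + `|c|)) p1.
exists (Num.max A 1) => [|x]; first by rewrite le_max A0.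
rewrite ge_max => /andP[/HA + x1]; rewrite ge_max => /andP[_ px].
apply: le_trans (bnd x); rewrite lerBrDr (le_trans px)//.
by rewrite ler_peMr.
Qed.

(** Outside a large interval a nonconstant p exceeds p(0). *)
Lemma poly_ge0_has_min (p : {poly R}) : (forall x, 0 <= p.[x]) ->
  exists x0, forall x, p.[x0] <= p.[x].
Proof.
move=> p0; have [p1|p1] := leqP (size p) 1.
  exists 0 => x; suff -> : p = (p`_0)%:P by rewrite !hornerC.
  exact: size1_polyC.
have [A A0 HA] := poly_coercive p.[0] p1.
have AA : - A <= A by rewrite (le_trans _ A0)// oppr_le0.
have [|x0 x0A Hx0] := @EVT_min R (horner p) (- A) A AA.
  exact/continuous_subspaceT/continuous_horner.
exists x0 => x; have [xA|Ax] := lerP `|x| A.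
  by apply: Hx0; rewrite in_itv /= -ler_norml.
rewrite (le_trans (Hx0 0 _))//; first by rewrite in_itv /= oppr_le0 A0.
by have := HA _ (ltW Ax); rewrite [leRHS]ger0_norm.
Qed.

Lemma horner_ge0_closed (p : {poly R}) x0 :
  (forall e, 0 < e -> exists2 x, `|x0 - x| < e & 0 <= p.[x]) -> 0 <= p.[x0].
Proof.
move=> H; rewrite leNgt; apply/negP => px0.
have /cvgrPdist_lt/(_ _ (_ : 0 < - p.[x0])) := @continuous_horner R p x0.
rewrite oppr_gt0 => /(_ px0) [e /= e0 He].
have [x xe px] := H e e0; have := He x xe.
by rewrite ltr0_norm ?ltr0B ?subr_lt0 ?(lt_le_trans px0)//; lra.
Qed.

(** A nonnegative polynomial does not change sign at a root, so the root is
double; the cofactor is nonnegative off the root, hence everywhere. *)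
Lemma poly_root_ge0 (p : {poly R}) x0 : (forall x, 0 <= p.[x]) -> root p x0 ->
  exists2 r : {poly R}, p = r * ('X - x0%:P) ^+ 2 & forall x, 0 <= r.[x].
Proof.
move=> p0 /factor_theorem [r1 pE].
have r1pos x : x0 < x -> 0 <= r1.[x].
  move=> x0x; have := p0 x; rewrite pE hornerM hornerXsubC.
  by rewrite pmulr_lge0// subr_gt0.
have r1neg x : x < x0 -> r1.[x] <= 0.
  move=> x0x; have := p0 x; rewrite pE hornerM hornerXsubC.
  by rewrite nmulr_lge0// subr_lt0.
have r10 : root r1 x0.
  rewrite rootE eq_le -oppr_ge0 -hornerN; apply/andP; split.
    apply: horner_ge0_closed => e e0; exists (x0 - e / 2).
      by rewrite opprB addrC subrK gtr0_norm; lra.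
    by rewrite hornerN oppr_ge0 r1neg//; lra.
  apply: horner_ge0_closed => e e0; exists (x0 + e / 2).
    by rewrite opprD addNKr normrN gtr0_norm; lra.
  by rewrite r1pos//; lra.
have /factor_theorem [r r1E] := r10.
exists r => [|x]; first by rewrite pE r1E expr2 mulrA.
have off y : y != x0 -> 0 <= r.[y].
  move=> yx0; have := p0 y; rewrite pE r1E !hornerM hornerXsubC -mulrA -expr2.
  by rewrite pmulr_lge0// exprn_even_gt0//= subr_eq0.
apply: horner_ge0_closed => e e0.
have [xx0|xx0] := eqVneq x x0; last first.
  by exists x; rewrite ?subrr ?normr0 ?off.
exists (x + e / 2); first by rewrite opprD addNKr normrN gtr0_norm; lra.
by apply: off; rewrite -xx0 gt_eqF//; lra.
Qed.

(** Subtracting the minimum m produces a root, hence a factor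
('X - x0)^2 whose cofactor is nonnegative of smaller degree. The constant m is
itself a square. *)
Lemma poly_ge0_sum_sqr (p : {poly R}) : (forall x, 0 <= p.[x]) ->
  exists qs : seq {poly R}, p = \sum_(q <- qs) q ^+ 2.
Proof.
have [n] := ubnP (size p); elim: n p => // n IHn p pn p0.
have [x0 x0min] := poly_ge0_has_min p0.
pose m := p.[x0].
have rt : root (p - m%:P) x0 by rewrite rootE hornerD hornerN hornerC subrr.
have pm0 x : 0 <= (p - m%:P).[x] by rewrite hornerD hornerN hornerC subr_ge0.
have mE : m%:P = (Num.sqrt m)%:P ^+ 2 :> {poly R}.
  by rewrite -polyC_exp sqr_sqrtr// /m p0.
have [r pE r0] := poly_root_ge0 pm0 rt.
have [req0|rneq0] := eqVneq r 0.
  exists [:: (Num.sqrt m)%:P]; rewrite big_seq1 -mE.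
  by apply/eqP; rewrite -subr_eq0 pE req0 mul0r.
have [|qs rE] := IHn r _ r0.
  rewrite ltnS in pn; apply: leq_trans pn.
  have : (size (p - m%:P)%R <= maxn (size p) 1)%N.
    rewrite (leq_trans (size_polyD _ _))// geq_max leq_maxl size_polyN.
    by rewrite (leq_trans (size_polyC_leq1 _))// leq_maxr.
  rewrite pE size_Mmonic ?monic_exp ?monicXsubC// size_exp_XsubC addn3 /=.
  by have := rneq0; rewrite -size_poly_gt0 => ?; lia.
exists ((Num.sqrt m)%:P :: [seq q * ('X - x0%:P) | q <- qs]).
rewrite big_cons big_map -mE.
under eq_bigr do rewrite exprMn.
by rewrite -mulr_suml -rE -pE addrC subrK.
Qed.

End NonnegativePolynomials.

Section PositiveMomentFunctional.
Context {R : realType} (s : nat -> R).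
Hypothesis s_gt0 : forall k, 0 < s k.
Hypothesis s_ineq : forall n, 4 * s n.+1 ^+ 2 <= s n * s n.+2.

Lemma moment_functional_ge0 (p : {poly R}) : (forall x, 0 <= p.[x]) ->
  0 <= moment_functional s p.
Proof.
move=> /poly_ge0_sum_sqr[qs ->]; rewrite linear_sum sumr_ge0// => q _.
have [->|q0] := eqVneq q 0; first by rewrite expr0n /= linear0.
exact/ltW/moment_functional_sqr_gt0.
Qed.

End PositiveMomentFunctional.

(** * The Hahn-Banach theorem for sublinear functionals *)

Section HahnBanach.
Context {R : realType} {V : lmodType R}.

Definition sublinear (p : V -> R) :=
  (forall x y, p (x + y) <= p x + p y) /\
  (forall t x, 0 <= t -> p (t *: x) <= t * p x).

(** [D x] collects the admissible upper values at [x]. The closure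
conditions are up to decreasing the value, so that infima over chains, over
rays and over majorants are all covered. *)
Lemma sublinear_inf (D : V -> set R) :
  (forall x, D x !=set0) -> (forall x, has_lbound (D x)) ->
  (forall x y a b, D x a -> D y b -> exists2 c, D (x + y) c & c <= a + b) ->
  (forall t x a, 0 <= t -> D x a -> exists2 c, D (t *: x) c & c <= t * a) ->
  sublinear (fun x => inf (D x)).
Proof.
move=> D0 Dlb Dadd Dscale; split=> [x y|t x t0].
  rewrite -lerBlDr; apply: lb_le_inf => // a xa.
  rewrite lerBlDr [a + _]addrC -lerBlDr; apply: lb_le_inf => // b yb.
  have [c Dc cab] := Dadd _ _ _ _ xa yb.
  by rewrite lerBlDr [b + a]addrC (le_trans _ cab)// ge_inf.
have [t00|tn0] := eqVneq t 0.
  have [a xa] := D0 x; have [c Dc ca] := Dscale t x a t0 xa.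
  have -> : t * inf (D x) = t * a by rewrite t00 !mul0r.
  exact: le_trans (ge_inf _ Dc) ca.
have tp : 0 < t by rewrite lt0r tn0.
rewrite mulrC -ler_pdivrMr//; apply: lb_le_inf => // a xa.
have [c Dc cta] := Dscale t x a t0 xa.
by rewrite ler_pdivrMr// mulrC (le_trans _ cta)// ge_inf.
Qed.

Section sublinear_theory.
Variable p : V -> R.
Hypothesis psub : sublinear p.

Lemma sublinear0 : p 0 = 0.
Proof.
have [padd psc] := psub; have := padd 0 0; have := psc 0 0 (lexx _).
by rewrite scale0r mul0r addr0; lra.
Qed.

Lemma sublinearZ t x : 0 <= t -> p (t *: x) = t * p x.
Proof.
have [padd psc] := psub; move=> t0; apply/eqP; rewrite eq_le psc//=.
have [->|tn0] := eqVneq t 0; first by rewrite mul0r scale0r sublinear0.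
have tp : 0 < t by rewrite lt0r tn0.
rewrite mulrC -ler_pdivlMr// mulrC.
by rewrite -{1}(scale1r x) -(mulVf tn0) -scalerA psc// invr_ge0.
Qed.

Lemma sublinearN x : - p (- x) <= p x.
Proof.
by rewrite lerNl -subr_ge0 opprK -sublinear0 -(addNr x) psub.1.
Qed.

(** Oddness turns subadditivity into superadditivity. *)
Lemma odd_sublinear_linear : (forall x, p (- x) <= - p x) ->
  (forall x y, p (x + y) = p x + p y) /\ (forall t x, p (t *: x) = t * p x).
Proof.
move=> podd.
have pN x : p (- x) = - p x.
  by apply/eqP; rewrite eq_le podd/= lerNl sublinearN.
split=> [x y|t x].
  apply/eqP; rewrite eq_le psub.1/=.
  by have := psub.1 (- x) (- y); rewrite -opprD !pN; lra.
have [t0|t0] := leP 0 t; first by rewrite sublinearZ.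
by rewrite -[t]opprK scaleNr pN sublinearZ ?mulNr// oppr_ge0 ltW.
Qed.

(** The largest decrease of [p] along the ray spanned by [v] that sublinearity
permits; its value at [- v] is at most [- p v], so a minimal
sublinear functional must be odd. *)
Definition sublinear_dir (v x : V) : R :=
  inf [set p (x + t *: v) - t * p v | t in [set t | 0 <= t]].

Lemma sublinear_dir_lbound v x :
  lbound [set p (x + t *: v) - t * p v | t in [set t | 0 <= t]] (- p (- x)).
Proof.
move=> _ [t /= t0 <-]; rewrite -sublinearZ//.
by have := psub.1 (x + t *: v) (- x); rewrite [x + _]addrC addrK; lra.
Qed.

Lemma sublinear_dir_le v x t : 0 <= t ->
  sublinear_dir v x <= p (x + t *: v) - t * p v.
Proof.
move=> t0; apply: ge_inf; last by exists t.
by exists (- p (- x)); exact: sublinear_dir_lbound.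
Qed.

Lemma sublinear_dir_sublinear v : sublinear (sublinear_dir v).
Proof.
apply: sublinear_inf.
- by move=> x; exists (p (x + 0 *: v) - 0 * p v); exists 0 => /=.
- by move=> x; exists (- p (- x)); exact: sublinear_dir_lbound.
- move=> x y _ _ [t /= t0 <-] [u /= u0 <-].
  exists (p (x + y + (t + u) *: v) - (t + u) * p v).
    by exists (t + u) => //=; rewrite addr_ge0.
  by have := psub.1 (x + t *: v) (y + u *: v); rewrite addrACA -scalerDl; lra.
- move=> c x _ c0 [t /= t0 <-].
  exists (p (c *: x + (c * t) *: v) - (c * t) * p v).
    by exists (c * t) => //=; rewrite mulr_ge0.
  by rewrite -scalerA -scalerDr sublinearZ// mulrBr mulrA.
Qed.

End sublinear_theory.

(** By Zorn's lemma there is a minimal sublinear functional below [p0]; it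
coincides with each of its [sublinear_dir] modifications, so it is odd, hence
linear. *)
Lemma hahn_banach (p0 : V -> R) : sublinear p0 ->
  exists l : V -> R, [/\ forall x, l x <= p0 x,
    forall x y, l (x + y) = l x + l y & forall t x, l (t *: x) = t * l x].
Proof.
move=> p0sub.
pose T := {p : V -> R | sublinear p /\ forall x, p x <= p0 x}.
pose le (p q : T) := `[< forall x, sval q x <= sval p x >].
have t0 : T by exists p0.
have [p [psub pp0] pmin] : exists2 p : V -> R, sublinear p /\ (forall x, p x <= p0 x) &
    forall q, sublinear q -> (forall x, q x <= p x) -> forall x, p x <= q x.
  have [] := @ZL_preorder T t0 le.
  - by move=> t; apply/asboolP.
  - move=> r s t /asboolP rs /asboolP st; apply/asboolP => x.
    exact: le_trans (st x) (rs x).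
  - move=> A Atot; have [[a Aa]|A0] := pselect (A !=set0); last first.
      by exists t0 => s As; case: A0; exists s.
    pose D x := [set sval t x | t in A].
    have D0 x : D x !=set0 by exists (sval a x); exists a.
    have Dlb x : has_lbound (D x).
      exists (- p0 (- x)) => _ [[t [tsub tp0]] _ <-] /=.
      by apply: le_trans (sublinearN tsub x); rewrite lerN2.
    have Dinf s x : A s -> inf (D x) <= sval s x by move=> As; apply: ge_inf => //; exists s.
    have infsub : sublinear (fun x => inf (D x)).
      apply: sublinear_inf => //.
      + move=> x y _ _ [s As <-] [t At <-].
        have [/asboolP st|/asboolP ts] := Atot s t As At.
          exists (sval t (x + y)); first by exists t.
          by rewrite (le_trans ((svalP t).1.1 x y))// lerD2r.
        exists (sval s (x + y)); first by exists s.
        by rewrite (le_trans ((svalP s).1.1 x y))// lerD2l.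
      + move=> c x _ c0 [s As <-]; exists (sval s (c *: x)); first by exists s.
        exact: (svalP s).1.2.
    have infle x : inf (D x) <= p0 x by rewrite (le_trans (Dinf a x Aa))// (svalP a).2.
    exists (exist _ (fun x => inf (D x)) (conj infsub infle)) => s As.
    by apply/asboolP => x /=; exact: Dinf.
  move=> [p [psub pp0]] pmax; exists p => // q qsub qp.
  have qp0 x : q x <= p0 x by rewrite (le_trans (qp x)).
  have /asboolP := pmax (exist _ q (conj qsub qp0)) (asboolT qp).
  by [].
have podd x : p (- x) <= - p x.
  have ple y : sublinear_dir p x y <= p y.
    by rewrite (le_trans (sublinear_dir_le psub x y (lexx 0)))// scale0r mul0r addr0 subr0.
  have := pmin _ (sublinear_dir_sublinear psub x) ple (- x).
  move=> /le_trans; apply.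
  rewrite (le_trans (sublinear_dir_le psub x (- x) ler01))//.
  by rewrite scale1r addNr sublinear0// mul1r sub0r.
have [padd pscale] := odd_sublinear_linear psub podd.
by exists p.
Qed.

End HahnBanach.

(** * A distribution function dominated by the moment functional *)

Section BoundedFunctions.
Context {R : realType}.

Definition bounded_pred : {pred R -> R^o} :=
  fun f => `[< exists C, forall x, `|f x| <= C >].

Lemma bounded_pred_submod : submod_closed bounded_pred.
Proof.
split=> [|c f g /asboolP[C Cf] /asboolP[D Dg]]; apply/asboolP.
  by exists 0 => x; rewrite normr0.
exists (`|c| * C + D) => x.
by rewrite (le_trans (ler_normD _ _))// lerD// normrM ler_wpM2l.
Qed.

HB.instance Definition _ :=
  GRing.isSubmodClosed.Build R (R -> R^o) bounded_pred bounded_pred_submod.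

Record bounded_function := BoundedFunction {
  bounded_val :> R -> R^o ; _ : bounded_val \in bounded_pred }.

HB.instance Definition _ := [isSub for bounded_val].
HB.instance Definition _ := [Choice of bounded_function by <:].
HB.instance Definition _ := [SubChoice_isSubLmodule of bounded_function by <:].

Lemma bounded_functionP (f : bounded_function) :
  exists C : R, forall x, `|f x| <= C.
Proof. by apply/asboolP; case: f. Qed.

Lemma half_line_bounded (a : R) : (fun x => (x <= a)%R%:R : R^o) \in bounded_pred.
Proof.
by apply/asboolP; exists 1 => x; rewrite ger0_norm ?ler0n// lern1 leq_b1.
Qed.

Definition half_line (a : R) : bounded_function := BoundedFunction (half_line_bounded a).

End BoundedFunctions.

Section Distribution.
Context {R : realType} (s : nat -> R).
Hypothesis L_ge0 : forall p : {poly R}, (forall x, 0 <= p.[x]) ->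
  0 <= moment_functional s p.

Local Notation L := (moment_functional s).

Lemma positive_moment_functional_le (p q : {poly R}) : (forall x, p.[x] <= q.[x]) ->
  L p <= L q.
Proof.
move=> pq; rewrite -subr_ge0 -linearB; apply: L_ge0 => x.
by rewrite hornerD hornerN subr_ge0.
Qed.

Let majorants (f : bounded_function (R := R)) : set R :=
  [set L p | p in [set p : {poly R} | forall x, f x <= p.[x]]].

Lemma majorants_sublinear : sublinear (fun f => inf (majorants f)).
Proof.
apply: sublinear_inf.
- move=> f; have [C Cf] := bounded_functionP f.
  exists (L C%:P); exists C%:P => //= x.
  by rewrite hornerC (le_trans (ler_norm _)).
- move=> f; have [C Cf] := bounded_functionP f.
  exists (L (- C)%:P) => _ [p fp <-].
  apply: positive_moment_functional_le => x; rewrite hornerC (le_trans _ (fp x))//.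
  by rewrite lerNl (le_trans (ler_norm _))// normrN.
- move=> f g _ _ [p fp <-] [q gq <-]; exists (L (p + q)); last by rewrite linearD.
  by exists (p + q) => //= x; rewrite hornerD lerD.
- move=> t f _ t0 [p fp <-]; exists (L (t *: p)); last by rewrite linearZ.
  by exists (t *: p) => //= x; rewrite hornerZ ler_wpM2l.
Qed.

(** [F x] is the value at the indicator of the half-line up to [x] of a
linear functional dominated by the infimum of L over polynomial majorants. The
conclusion is all that the construction of the measure uses: it gives
the monotonicity of F, its total mass, and the bound on integrals. *)
Lemma exists_distribution : exists F : R -> R,
  forall n (m a b : 'I_n -> R) (p : {poly R}),
    (forall x, \sum_i m i * ((x <= b i)%R%:R - (x <= a i)%R%:R) <= p.[x]) ->
    \sum_i m i * (F (b i) - F (a i)) <= L p.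
Proof.
have [l [l_le ladd lscale]] := hahn_banach majorants_sublinear.
have l0 : l 0 = 0 by rewrite -(scale0r 0) lscale mul0r.
have lN f : l (- f) = - l f by rewrite -scaleN1r lscale mulN1r.
exists (fun x => l (half_line x)) => n m a b p mp.
pose f : bounded_function (R := R) :=
  \sum_i m i *: (half_line (b i) - half_line (a i)).
have -> : \sum_i m i * (l (half_line (b i)) - l (half_line (a i))) = l f.
  rewrite /f (big_morph l ladd l0); apply: eq_bigr => i _.
  by rewrite lscale ladd lN.
apply: le_trans (l_le f) _; apply: ge_inf; last first.
  exists p => //= x; apply: le_trans (mp x).
  rewrite le_eqVlt; apply/orP; left; apply/eqP.
  rewrite /f -[bounded_val _]/(val _) raddf_sum /= fct_sumE; apply: eq_bigr => i _.
  by [].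
have [C Cf] := bounded_functionP f.
exists (L (- C)%:P) => _ [q fq <-].
apply: positive_moment_functional_le => x; rewrite hornerC (le_trans _ (fq x))//.
by rewrite lerNl (le_trans (ler_norm _))// normrN.
Qed.

End Distribution.

(** * Integrals against the Stieltjes measure *)

Section StieltjesMeasure.
Context {R : realType} (F : R -> R) (ndF : nondecreasing F).

Local Notation G := (right_limit ndF).
Local Notation mu := (stieltjes_measure ndF).

Lemma stieltjes_measure_itv (a b : R) : a <= b -> mu `]a, b]%classic = (G b - G a)%:E.
Proof.
move=> ab; rewrite /stieltjes_measure/= /lebesgue_stieltjes_measure/= /measure_extension/=.
by rewrite measurable_mu_extE/= ?wlength_itv_bnd//; exact: is_ocitv.
Qed.

Lemma right_limit_cvg_seq x : F (x + n.+1%:R^-1) @[n --> \oo] --> G x.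
Proof.
have /cvg_at_rightP := right_limit_cvg (ndF := ndF) (x := x); apply; split.
  by move=> n; rewrite ltrDl.
rewrite -[X in _ --> X]addr0; apply: cvgD; first exact: cvg_cst.
exact: cvg_harmonic.
Qed.

End StieltjesMeasure.

(** At most one cell of an increasing grid contains [x], so a step function
on the grid takes the value of that cell, or vanishes outside the grid. *)
Lemma grid_step {R : realType} (c : nat -> R) (m : nat -> R) (x : R) n :
  (forall i, c i <= c i.+1) ->
  let S := \sum_(i < n) m i * ((x <= c i.+1)%R%:R - (x <= c i)%R%:R) in
  (exists i, [/\ (i < n)%N, c i < x, x <= c i.+1 & S = m i]) \/
  (S = 0 /\ (x <= c 0%N \/ c n < x)).
Proof.
move=> cS /=.
have cmono i j : (i <= j)%N -> c i <= c j.
  by move=> ij; apply: (homo_leq lexx le_trans cS).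
elim: n => [|n IHn].
  by right; rewrite big_ord0; split => //; have [xc|xc] := leP x (c 0%N); [left|right].
rewrite big_ord_recr /=.
have [[i [ni cx xc ->]]|[-> xc]] := IHn.
  left; exists i; split => //; first exact: ltnW.
  have xn : x <= c n := le_trans xc (cmono _ _ ni).
  by rewrite xn (le_trans xn (cS n)) subrr mulr0 addr0.
rewrite add0r; have [x0|x0] := leP x (c 0%N).
  right; split; last by left.
  have xn : x <= c n := le_trans x0 (cmono _ _ (leq0n n)).
  by rewrite xn (le_trans xn (cS n)) subrr mulr0.
have xn : c n < x by case: xc => //; rewrite leNgt x0.
have [xS|xS] := leP x (c n.+1).
  by left; exists n; split => //; rewrite leNgt xn/= subr0 mulr1.
right; split; last by right.
by rewrite (leNgt x (c n)) xn/= subr0 mulr0.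
Qed.

Section MomentInequality.
Context {R : realType} (s : nat -> R) (F : R -> R) (ndF : nondecreasing F).

Local Notation L := (moment_functional s).
Local Notation G := (right_limit ndF).
Local Notation mu := (stieltjes_measure ndF).

Hypothesis F_le_L : forall n (m a b : 'I_n -> R) (p : {poly R}),
  (forall x, \sum_i m i * ((x <= b i)%R%:R - (x <= a i)%R%:R) <= p.[x]) ->
  \sum_i m i * (F (b i) - F (a i)) <= L p.

(** The bound on [F] passes to its right-continuous version: the partition
points are shifted to the right by a vanishing amount. *)
Lemma right_limit_le_L n (m a b : 'I_n -> R) (p : {poly R}) :
  (\forall k \near \oo, forall x, \sum_i m i *
    ((x <= b i + k.+1%:R^-1)%R%:R - (x <= a i + k.+1%:R^-1)%R%:R) <= p.[x]) ->
  \sum_i m i * (G (b i) - G (a i)) <= L p.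
Proof.
move=> Hk.
have cv : (fun k => \sum_i m i * (F (b i + k.+1%:R^-1) - F (a i + k.+1%:R^-1)))
    @ \oo --> \sum_i m i * (G (b i) - G (a i)).
  apply: cvg_big => [|i _]; first exact: add_continuous.
  by apply: cvgM; [exact: cvg_cst|apply: cvgB; exact: right_limit_cvg_seq].
apply: (cvgr_to_le cv); near=> k; apply: F_le_L.
by near: k.
Unshelve. all: by end_near. Qed.

Section lower_step_functions.
Variable p : {poly R}.
Hypothesis p_ge0 : forall x, 0 <= p.[x].

(* The interval ]-(k+1), k+1] is cut into cells of length 1/(k+1). The lower
   value on a cell is the infimum of p over a window twice as long, so that it
   stays below p when the cell is shifted to the right by at most one mesh. *)
Let mesh k : R := k.+1%:R^-1.
Let node k i : R := - k.+1%:R + i%:R * mesh k.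
Let ncells k := (2 * k.+1 * k.+1)%N.
Let window k i : set R := [set p.[u] | u in `[node k i, node k i + 2 * mesh k]].
Let lower k i : R := inf (window k i).
Let cell k i : set (measurableTypeR R) := `]node k i, node k i.+1]%classic.
Let lower_step k (x : R) : R :=
  \sum_(i < ncells k) lower k i * \1_(cell k i) x.

Let mesh_gt0 k : 0 < mesh k. Proof. by rewrite invr_gt0. Qed.

Let nodeS k i : node k i.+1 = node k i + mesh k.
Proof. by rewrite /node -[i.+1%:R]natr1 mulrDl mul1r addrA. Qed.

Let node_le k i : node k i <= node k i.+1.
Proof. by rewrite nodeS lerDl ltW. Qed.

Let node_last k : node k (ncells k) = k.+1%:R.
Proof.
rewrite /node /ncells /mesh natrM mulfK ?pnatr_eq0// natrM; ring.
Qed.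

Let lower_ge0 k i : 0 <= lower k i.
Proof.
apply: lb_le_inf => [|_ [u _ <-]//].
exists p.[node k i]; exists (node k i) => //=.
by rewrite in_itv /= lexx lerDl mulr_ge0// ltW.
Qed.

Let lower_le k i u : node k i <= u <= node k i + 2 * mesh k -> lower k i <= p.[u].
Proof.
move=> iu; apply: ge_inf; first by exists 0 => _ [v _ <-].
by exists u => //=; rewrite in_itv.
Qed.

Let cellE k i (x : R) : \1_(cell k i) x = (x <= node k i.+1)%R%:R - (x <= node k i)%R%:R :> R.
Proof.
rewrite indicE mem_setE /= in_itv /= ltNge.
have [xi|xi] /= := leP x (node k i); last by rewrite subr0.
by rewrite (le_trans xi (node_le _ _)) subrr.
Qed.

Let cell_measurable k i : measurable (cell k i).
Proof. exact: measurable_itv. Qed.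

Let indic_cell_measurable k i :
  measurable_fun [set: measurableTypeR R] (\1_(cell k i) : _ -> R).
Proof. exact: measurable_indic. Qed.

Let lower_step_cvg x : lower_step k x @[k --> \oo] --> p.[x].
Proof.
apply/cvgrPdist_le => e e0.
have /cvgrPdist_le/(_ e e0) [d /= d0 Hd] := @continuous_horner R p x.
have d20 : 0 < d / 2 by rewrite divr_gt0.
near=> k.
have kd : 2 * mesh k < d.
  by rewrite mulrC -ltr_pdivlMr//; near: k; exact: near_infty_natSinv_lt (PosNum d20).
have kx : `|x| < k.+1%:R.
  apply: (@lt_trans _ _ k%:R); last by rewrite ltr_nat.
  by near: k; exact: nbhs_infty_gtr.
rewrite /lower_step; under eq_bigr do rewrite cellE.
have [[i [_ ix xi ->]]|[_ [x0|x0]]] :=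
    grid_step (lower k) x (ncells k) (node_le k); last 2 first.
- move: x0; rewrite /node mul0r addr0 => x0.
  by move: kx; rewrite ltr_norml => /andP[]; rewrite ltNge x0.
- by move: x0; rewrite node_last => x0; move: kx; rewrite ltr_norml => /andP[_]; rewrite ltNge ltW.
have m0 := mesh_gt0 k; rewrite nodeS in xi.
rewrite ger0_norm ?subr_ge0; last by apply: lower_le; rewrite ltW//=; lra.
rewrite lerBlDr -lerBlDl; apply: lb_le_inf.
  exists p.[node k i]; exists (node k i) => //=.
  by rewrite in_itv /= lexx lerDl mulr_ge0// ltW.
move=> _ [u /= + <-]; rewrite in_itv /= => /andP[iu ui].
have /Hd : ball x d u by rewrite /ball /= ltr_norml; apply/andP; split; lra.
by rewrite ler_norml => /andP[_]; lra.
Unshelve. all: by end_near. Qed.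

Let integral_lower_step_le k : (\int[mu]_x (lower_step k x)%:E <= (L p)%:E)%E.
Proof.
have -> : (\int[mu]_x (lower_step k x)%:E)%E =
    (\sum_(i < ncells k) lower k i * (G (node k i.+1) - G (node k i)))%:E.
  under eq_integral do rewrite /lower_step -sumEFin.
  rewrite ge0_integral_sum//; last 2 first.
  - by move=> i; apply/measurable_EFinP; exact: measurable_funM.
  - by move=> i x _; rewrite lee_fin mulr_ge0.
  rewrite -sumEFin; apply: eq_bigr => i _.
  under eq_integral do rewrite EFinM.
  rewrite ge0_integralZl//.
  - by rewrite integral_indic//= setIT stieltjes_measure_itv.
  - exact/measurable_EFinP.
  - by rewrite lee_fin.
rewrite lee_fin.
apply: (@right_limit_le_L (ncells k) (fun i => lower k i)
  (fun i => node k i) (fun i => node k i.+1)).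
exists k => // j /= kj x.
have jk : mesh j <= mesh k by rewrite lef_pV2 ?posrE// ler_nat.
have mj := mesh_gt0 j; rewrite -/(mesh j).
have [|[i [_ ix xi ->]]|[-> _]//] :=
  @grid_step _ (fun i => node k i + mesh j) (lower k) x (ncells k).
  by move=> i; rewrite lerD2r.
by apply: lower_le; rewrite nodeS in xi; apply/andP; split; lra.
Qed.

(** The lower step functions converge pointwise to p and their integrals are at
most L p, so Fatou's lemma applies. *)
Lemma integral_le_L : (\int[mu]_x (p.[x])%:E <= (L p)%:E)%E.
Proof.
have -> : (\int[mu]_x (p.[x])%:E =
    \int[mu]_x limn_einf (fun k => (lower_step k x)%:E))%E.
  apply: eq_integral => x _.
  have lcvg : (lower_step k x)%:E @[k --> \oo] --> (p.[x])%:E.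
    apply/fine_cvgP; split; first exact: nearW.
    exact: lower_step_cvg.
  by have [-> _] := cvg_limn_einf_sup lcvg.
apply: le_trans (fatou _ _ _ _) _ => //.
- move=> k; apply/measurable_EFinP; apply: measurable_sum => i.
  exact: measurable_funM.
- by move=> k x _; rewrite lee_fin sumr_ge0// => i _; rewrite mulr_ge0.
rewrite limn_einf_lim; apply: lime_le; first exact: is_cvg_einfs.
apply: nearW => k; apply: le_trans (integral_lower_step_le k).
by apply: ereal_inf_lbound; exists k => /=.
Qed.

End lower_step_functions.

End MomentInequality.

(** * Equality of the moments and points of growth *)

Section MomentEquality.
Context {R : realType} (s : nat -> R) (F : R -> R) (ndF : nondecreasing F).

Local Notation L := (moment_functional s).
Local Notation G := (right_limit ndF).
Local Notation mu := (stieltjes_measure ndF).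

Hypothesis F_le_L : forall n (m a b : 'I_n -> R) (p : {poly R}),
  (forall x, \sum_i m i * ((x <= b i)%R%:R - (x <= a i)%R%:R) <= p.[x]) ->
  \sum_i m i * (F (b i) - F (a i)) <= L p.

Let int_le_L := @integral_le_L R s F ndF F_le_L.

(** The polynomial 4 x^2 / A^2 - 1 majorizes the opposite of the indicator of
every interval close to ]-A, A]; the factor 4 leaves room for the shift of the
end points. *)
Lemma chebyshev_mass (A : R) : 0 < A ->
  s 0%N - 4 * s 2%N / A ^+ 2 <= G A - G (- A).
Proof.
move=> A0; pose p : {poly R} := (4 / A ^+ 2) *: 'X^2 - 1.
have Lp : L p = 4 / A ^+ 2 * s 2%N - s 0%N.
  by rewrite linearB linearZ /= moment_functionalXn moment_functional1.
suff : - 1 * (G A - G (- A)) <= L p.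
  by rewrite Lp mulN1r [4 * _ / _]mulrAC; lra.
have := @right_limit_le_L _ s F ndF F_le_L 1 (fun=> - 1) (fun=> - A) (fun=> A) p.
rewrite big_ord1; apply.
have A20 : 0 < A / 2 by rewrite divr_gt0.
near=> k => x; rewrite big_ord1.
have kA : k.+1%:R^-1 < A / 2.
  by near: k; exact: near_infty_natSinv_lt (PosNum A20).
have k0 : 0 < k.+1%:R^-1 :> R by rewrite invr_gt0.
set h := k.+1%:R^-1 in kA k0 *.
have px : p.[x] = 4 / A ^+ 2 * x ^+ 2 - 1.
  by rewrite /p hornerD hornerN hornerC hornerZ hornerXn.
have p1 : - 1 <= p.[x] by rewrite px lerDr mulr_ge0 ?sqr_ge0// divr_ge0 ?sqr_ge0.
have pout : (A / 2) ^+ 2 <= x ^+ 2 -> 0 <= p.[x].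
  move=> Ax; rewrite px subr_ge0 mulrAC ler_pdivlMr ?exprn_gt0// mul1r.
  by move: Ax; rewrite expr_div_n; lra.
have [xA|xA] := leP x (- A + h).
  have -> : x <= A + h by lra.
  rewrite subrr mulr0; apply: pout.
  by rewrite -[leRHS]sqrrN ler_pXn2r ?nnegrE//; lra.
have [xA'|xA'] /= := leP x (A + h); rewrite subr0 ?mulr1// mulr0.
by apply: pout; rewrite ler_pXn2r ?nnegrE//; lra.
Unshelve. all: by end_near. Qed.

Lemma stieltjes_mass : mu setT = (s 0%N)%:E.
Proof.
have le : (mu setT <= (s 0%N)%:E)%E.
  have := @int_le_L 1 (fun x => _); rewrite moment_functional1.
  under eq_integral do rewrite hornerC.
  rewrite (integral_cst mu measurableT 1%R%:E) mul1e; apply => x.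
  by rewrite hornerC.
have fin : mu setT \is a fin_num.
  by rewrite ge0_fin_numE// (le_lt_trans le)// ltry.
apply/eqP; rewrite eq_le le /= -(fineK fin) lee_fin.
apply/ler_addgt0Pr => e e0.
pose A := 1 + 4 * `|s 2%N| / e.
have A1 : 1 <= A by rewrite lerDl divr_ge0 ?mulr_ge0// ltW.
have A0 : 0 < A by rewrite (lt_le_trans _ A1).
have AA : - A <= A by lra.
have sA : 4 * s 2%N / A ^+ 2 <= e.
  rewrite ler_pdivrMr ?exprn_gt0//.
  apply: (@le_trans _ _ (e * A)).
    rewrite /A mulrDr mulr1 [e * (_ / e)]mulrC divfK ?gt_eqF//.
    by have := ler_norm (s 2%N); lra.
  by rewrite ler_pM2l// expr2 ler_peMr// ltW.
have : ((G A - G (- A))%:E <= mu setT)%E.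
  rewrite -stieltjes_measure_itv//; apply: le_measure => //; exact/mem_set.
rewrite -(fineK fin) lee_fin; have := chebyshev_mass A0; lra.
Qed.

Lemma horner_measurable (p : {poly R}) :
  measurable_fun [set: measurableTypeR R] (horner p : _ -> R).
Proof. by apply: continuous_measurable_fun => x; exact: continuous_horner. Qed.

(** |p| <= p^2 + 1, and the integral of the latter is bounded by L. *)
Lemma horner_integrable (p : {poly R}) :
  mu.-integrable setT (fun x => (p.[x])%:E).
Proof.
apply: (@le_integrable _ _ _ mu setT measurableT _ (fun x => ((p ^+ 2 + 1).[x])%:E)).
- by apply/measurable_EFinP; exact: horner_measurable.
- move=> x _ /=; rewrite lee_fin hornerD hornerC horner_exp.
  rewrite [leRHS]ger0_norm ?addr_ge0 ?sqr_ge0//.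
  have := sqr_ge0 (`|p.[x]| - 1); rewrite sqrrB real_normK ?num_real//.
  have := sqr_ge0 p.[x]; lra.
- apply/integrableP; split; first by apply/measurable_EFinP; exact: horner_measurable.
  have q0 x : 0 <= (p ^+ 2 + 1).[x].
    by rewrite hornerD hornerC horner_exp addr_ge0 ?sqr_ge0.
  under eq_integral => x _ do rewrite gee0_abs ?lee_fin//.
  exact: le_lt_trans (int_le_L q0) (ltry _).
Qed.

(* The functional E of the introduction: positive, and zero at 1. *)
Let defect (p : {poly R}) : R := L p - \int[mu]_x p.[x].

Let defect_ge0 p : (forall x, 0 <= p.[x]) -> 0 <= defect p.
Proof.
move=> p0; rewrite subr_ge0 -lee_fin /Rintegral fineK.
  exact: int_le_L.
exact: integrable_fin_num (horner_integrable p).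
Qed.

Let defect1 : defect 1 = 0.
Proof.
rewrite /defect moment_functional1; apply/eqP; rewrite subr_eq0; apply/eqP.
rewrite /Rintegral; under eq_integral do rewrite hornerC.
by rewrite (integral_cst mu measurableT 1%R%:E) mul1e stieltjes_mass.
Qed.

Let defectD p q : defect (p + q) = defect p + defect q.
Proof.
rewrite /defect linearD; under eq_Rintegral do rewrite hornerD.
rewrite RintegralD//; [|exact: horner_integrable|exact: horner_integrable].
by rewrite opprD addrACA.
Qed.

Let defectZ t p : defect (t *: p) = t * defect p.
Proof.
rewrite /defect linearZ /=; under eq_Rintegral do rewrite hornerZ.
by rewrite RintegralZl//; [rewrite mulrBr|exact: horner_integrable].
Qed.

(** Cauchy-Schwarz for the defect: E((t + p)^2) = 2 t E(p) + E(p^2) is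
nonnegative for every t, which forces E(p) = 0. *)
Lemma integral_horner (p : {poly R}) : (\int[mu]_x (p.[x])%:E = (L p)%:E)%E.
Proof.
rewrite -(fineK (integrable_fin_num measurableT (horner_integrable p))).
congr EFin; apply/esym/eqP; rewrite -subr_eq0 -[_ - _]/(defect p).
have quad t : 0 <= 2 * t * defect p + defect (p ^+ 2).
  have : 0 <= defect ((t%:P + p) ^+ 2).
    by apply: defect_ge0 => x; rewrite horner_exp sqr_ge0.
  have -> : (t%:P + p) ^+ 2 = (t ^+ 2) *: 1 + ((2 * t) *: p + p ^+ 2).
    by rewrite -!mul_polyC !polyCM; ring.
  by rewrite !defectD !defectZ defect1 mulr0 add0r.
apply/negPn/negP => d0.
(* This t makes the expression equal to -1. *)
have := quad (- (defect (p ^+ 2) + 1) / (2 * defect p)).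
have -> : 2 * (- (defect (p ^+ 2) + 1) / (2 * defect p)) * defect p =
    - (defect (p ^+ 2) + 1) by field.
by lra.
Qed.

Lemma stieltjes_moments : moment_sequence ndF s.
Proof.
move=> k; split.
  have := horner_integrable 'X^k.
  by under eq_fun do rewrite hornerXn.
rewrite -(moment_functionalXn s) -integral_horner.
by under eq_integral do rewrite hornerXn.
Qed.

(** A point that is not of growth lies in an interval with rational end
points that has measure zero, and there are countably many such intervals. *)
Lemma stieltjes_null_nongrowth : mu.-negligible [set x | ~ growth_point F x].
Proof.
pose I k : set (measurableTypeR R) :=
  if (unpickle k : option (rat * rat)) is Some ab then
    (if mu `]ratr ab.1, ratr ab.2]%classic == 0%E then `]ratr ab.1, ratr ab.2]%classic
     else set0) else set0.
apply: (@negligibleS _ _ _ mu (\bigcup_k I k)); last first.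
  apply: negligible_bigcup => k; rewrite /I.
  case: unpickle => [[a b]|] /=; last exact: negligible_set0.
  case: eqP => [ab0|_]; last exact: negligible_set0.
  by apply/negligibleP => //; exact: measurable_itv.
move=> x /= xg.
have [e e0 Fe] : exists2 e, 0 < e & F (x + e) <= F (x - e).
  apply: contrapT => H; apply: xg => e e0; rewrite ltNge; apply/negP => Fe.
  by apply: H; exists e.
have [a] := @rat_in_itvoo R (x - e) x (ltac:(lra)).
rewrite in_itv /= => /andP[ea ax].
have [b] := @rat_in_itvoo R x (x + e) (ltac:(lra)).
rewrite in_itv /= => /andP[xb be].
have [k kE] : exists k, unpickle k = Some (a, b).
  by exists (pickle (a, b)); rewrite pickleK.
exists k; [by []|rewrite /I kE /=].
have ab : ratr a <= ratr b :> R by lra.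
rewrite stieltjes_measure_itv//.
suff -> : G (ratr b) = G (ratr a) by rewrite subrr eqxx /= in_itv /= ax ltW.
apply/eqP; rewrite eq_le (right_limit_nd ndF ab) andbT.
rewrite (le_trans (right_limit_le ndF be))// (le_trans Fe)//.
by rewrite (le_trans (ndF (ltW ea)))// right_limit_ge.
Qed.

(** Otherwise dF is carried by the finitely many roots of a polynomial p, and the
integral of p^2 vanishes. *)
Lemma infinite_growth : (forall p : {poly R}, p != 0 -> 0 < L (p ^+ 2)) ->
  infinite_set [set x | growth_point F x].
Proof.
move=> Lpos /finite_seqP[r rE].
pose p : {poly R} := \prod_(a <- r) ('X - a%:P).
have p0 : p != 0 by rewrite monic_neq0// monic_prod_XsubC.
have := Lpos p p0; rewrite -lte_fin -integral_horner.
rewrite (@ae_eq_integral _ _ _ mu setT (cst 0%E))//.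
- by rewrite integral0 ltxx.
- by apply/measurable_EFinP; exact: horner_measurable.
apply: negligibleS stieltjes_null_nongrowth => x /= H xg; apply: H => _.
have : [set` r] x by rewrite -rE.
move=> /= xr; rewrite horner_exp.
suff /eqP -> : root p x by rewrite expr0n.
by rewrite root_prod_XsubC.
Qed.

End MomentEquality.

Theorem mainTheorem8 (R : realType) (s : nat -> R)
    (s_gt0 : forall k : nat, 0 < s k)
    (s_ineq : forall n : nat, (1 <= n)%N ->
      s n.-1 * s n.+1 >= 4 * s n ^+ 2) :
  hamburger_moment_sequence s.
Proof.
have s_ineqS n : 4 * s n.+1 ^+ 2 <= s n * s n.+2 by exact: (s_ineq n.+1).
have L_ge0 := moment_functional_ge0 s_gt0 s_ineqS.
have [F F_le_L] := exists_distribution L_ge0.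
have ndF : nondecreasing F.
  move=> x y xy; have := F_le_L 1 (fun=> - 1) (fun=> x) (fun=> y) 0.
  rewrite big_ord1 linear0 mulN1r oppr_le0 subr_ge0; apply => u.
  rewrite big_ord1 horner0 mulN1r oppr_le0 subr_ge0 ler_nat.
  by have [ux|//] := leP u x; rewrite (le_trans ux xy).
split=> //; exists F, ndF; split; first exact: stieltjes_moments.
apply: (infinite_growth ndF F_le_L) => p.
exact: (moment_functional_sqr_gt0 s_gt0 s_ineqS).
Qed.
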